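(* For every positive integer $D$ and every positive integer $k$ for which there exists an affine plane of order $k$, there exist a $k$-uniform $k$-simple hypergraph $\mathcal{H}$ of maximum degree at most $D$ and an edge $e\in E(\mathcal{H})$ such that $$b_{L(\mathcal{H}),\,kD}(e)=1-\frac{k-1}{2k^2}+\frac{(k-1)(k-2)}{6k^4}+o(1),$$ where (for fixed $k$) the $o(1)$ term goes to $0$ as $D\to\infty$. In particular, for every positive integer $D$, there exist a $3$-uniform $3$-simple hypergraph $\mathcal{H}$ of maximum degree at most $D$ and an edge $e\in E(\mathcal{H})$ such that $$b_{L(\mathcal{H}),\,3D}(e)\ge 1-\frac{1}{9}+\frac{1}{3^5}-o(1).$$
   Context: A hypergraph $\mathcal{H}$ consists of a vertex set $V(\mathcal{H})$ and a multiset $E(\mathcal{H})$ of edges, each a subset of $V(\mathcal{H})$ (repeated edges are allowed and copies count as distinct edges). It is $k$-uniform if every edge has size $k$, and $t$-simple if every two distinct edges intersect in at most $t$ vertices (so for a $k$-uniform hypergraph, being $k$-simple is no restriction). The degree of a vertex is the number of edges (with multiplicity) containing it. The line graph $L(\mathcal{H})$ is the simple graph whose vertices are the edges of $\mathcal{H}$ (with multiplicity), two distinct edges being adjacent iff they intersect. For a graph $G$ and $v\in V(G)$, let $P_G(v):=\binom{\deg_G(v)}{2}-|E(N_G(v))|$ be the number of non-adjacent (unordered) pairs of distinct vertices in $N_G(v)$, where $E(N_G(v))$ is the set of edges of $G$ with both ends in $N_G(v)$, and let $T_G(v)$ be the number of $3$-element subsets of $N_G(v)$ that are pairwise non-adjacent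 in $G$. For a number $M\ge\Delta(G)$, define $$b_{G,M}(v):=\frac{\deg_G(v)}{M}-\frac{P_G(v)}{M^2}+\frac{T_G(v)}{M^3}.$$ *)

(* Defs.v *)
From HB Require Import structures.
From mathcomp Require Import all_boot all_order all_algebra.

Set Implicit Arguments.
Unset Strict Implicit.
Unset Printing Implicit Defensive.

Import Order.TTheory GRing.Theory Num.Theory.

(* The multiset of edges is a family of vertex sets indexed by a finite type,
   so that copies of the same vertex set are distinct edges. *)
Record hypergraph := Hypergraph {
  hvertex : finType;
  hedge : finType;
  ends : hedge -> {set hvertex}
}.

Definition uniform (k : nat) (H : hypergraph) : Prop :=
  forall e : hedge H, #|ends e| = k.

Definition t_simple (t : nat) (H : hypergraph) : Prop :=
  forall e f : hedge H, e != f -> #|ends e :&: ends f| <= t.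

Definition hdegree (H : hypergraph) (v : hvertex H) : nat :=
  #|[set e : hedge H | v \in ends e]|.

Definition max_hdegree (H : hypergraph) : nat :=
  \max_(v : hvertex H) hdegree v.

Record sgraph := SGraph {
  svertex :> finType;
  adj : rel svertex;
  adj_sym : symmetric adj;
  adj_irrefl : irreflexive adj
}.

Definition line_adj (H : hypergraph) : rel (hedge H) :=
  fun e f => (e != f) && (ends e :&: ends f != set0).

Lemma line_adj_sym (H : hypergraph) : symmetric (@line_adj H).
Proof. by move=> e f; rewrite /line_adj eq_sym setIC. Qed.

Lemma line_adj_irrefl (H : hypergraph) : irreflexive (@line_adj H).
Proof. by move=> e; rewrite /line_adj eqxx. Qed.

Definition line_graph (H : hypergraph) : sgraph :=
  SGraph (@line_adj_sym H) (@line_adj_irrefl H).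

Section LocalCounts.
Variable G : sgraph.

Definition nbhd (v : G) : {set G} := [set w | adj v w].

Definition degree (v : G) : nat := #|nbhd v|.

Definition max_degree : nat := \max_(v : G) degree v.

Definition edges_in (A : {set G}) : {set {set G}} :=
  [set [set x; y] | x in A, y in A & adj x y].

(* Integer-valued, so that the subtraction is not truncated. *)
Definition nonadj_pairs (v : G) : int :=
  ('C(degree v, 2)%:Z - #|edges_in (nbhd v)|%:Z)%R.

Definition nonadj_triples (v : G) : nat :=
  #|[set A : {set G} | [&& A \subset nbhd v, #|A| == 3 &
      [forall x in A, forall y in A, ~~ adj x y]]]|.

End LocalCounts.

(* Only meant for M >= max_degree G; see max_degree_line_graph for the
   case G = L(H), M = k D. *)
Definition bfun (R : fieldType) (G : sgraph) (M : R) (v : G) : R :=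
  ((degree v)%:R / M - (nonadj_pairs v)%:~R / M ^+ 2
   + (nonadj_triples v)%:R / M ^+ 3)%R.

Lemma max_degree_line_graph (H : hypergraph) (k D : nat) :
  uniform k H -> max_hdegree H <= D -> max_degree (line_graph H) <= k * D.
Proof.
move=> unifH degH; apply/bigmax_leqP => /= e _.
have sub : nbhd (G := line_graph H) e
    \subset \bigcup_(v in ends e) [set f | v \in ends f].
  apply/subsetP=> f; rewrite inE /= => /andP[_ /set0Pn[v]].
  rewrite inE => /andP[ve vf].
  by apply/bigcupP; exists v; rewrite ?inE.
apply: leq_trans (subset_leq_card sub) _.
apply: leq_trans (_ : \sum_(v in ends e) hdegree v <= _).
  elim/big_rec2: _ => [|v n A _ IH]; first by rewrite cards0.
  by rewrite (leq_trans (leq_card_setU _ _)) // leq_add2l.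
rewrite -(unifH e) -sum_nat_const; apply: leq_sum => v _.
by apply: leq_trans degH; apply: leq_bigmax.
Qed.

(* Lines are sets of points.  The three points in the nondegeneracy axiom are
   required to be distinct: otherwise one point without lines would qualify. *)
Record affine_plane := AffinePlane {
  point : finType;
  lines : {set {set point}};
  line_through : forall p q : point, p != q ->
    exists! l : {set point}, [/\ l \in lines, p \in l & q \in l];
  parallel_through : forall (l : {set point}) (p : point),
    l \in lines -> p \notin l ->
    exists! m : {set point}, [/\ m \in lines, p \in m & [disjoint m & l]];
  noncollinear : exists p q r : point, uniq [:: p; q; r] /\
    (forall l : {set point}, l \in lines -> ~~ [&& p \in l, q \in l & r \in l])
}.

Definition has_order (A : affine_plane) (k : nat) : Prop :=
  forall l : {set point A}, l \in lines A -> #|l| = k.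

(* Main.v *)
Require Import Defs.
From mathcomp Require Import all_boot all_order all_algebra ring.
Import Order.TTheory GRing.Theory Num.Theory.

Set Implicit Arguments.
Unset Strict Implicit.
Unset Printing Implicit Defensive.

(** The edges of the hypergraph are a line [e] of an affine plane of order [k],
    taken once, and every line that crosses [e] (meets it without being equal to
    it), repeated [mult := D.-1 %/ k] times; the lines parallel to [e] are
    discarded.  Every point lies on exactly [k] lines crossing [e], so all
    degrees are at most [k * mult + 1 <= D], and since the [k * k] crossing
    lines all meet [e], the degree of [e] in the line graph is [k * k * mult],
    nearly the maximum [k * D].  Two neighbours of [e] are non-adjacent exactly
    when they are copies of distinct parallel lines: non-adjacency splits the
    neighbourhood of [e] into [k] complete [k]-partite graphs, one for each
    parallel class other than that of [e], whose parts are the sets of [mult]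
    copies of one line.
    Hence a neighbour of [e] has [(k - 1) * mult] non-neighbours there, and a
    non-adjacent pair has [(k - 2) * mult] common ones
    ([blowup_parallels], [blowup_common_parallels]).

    With [t = k * mult / D], this gives
      [b(e) = t - (k-1)/(2 k^2) t^2 + (k-1)(k-2)/(6 k^4) t^3]
    ([bfun_blowup]).  Rounding costs at most [k / D] in [t], so [t] tends
    to 1 as [D] grows ([saturation_cvg]), and the error term is the difference
    between the values of this polynomial at [t] and at 1.

    The pairs and triples that [bfun] counts are treated uniformly as stable
    (independent) sets of size 2 and 3, which a recursion on their size counts
    ([card_stable_setsS]); the plane contributes the numbers of lines through a
    point and of parallels to a line ([card_crossing_through],
    [card_parallels]).  For [k = 3] the plane is the one over the field with
    three elements ([field_plane]). *)

(** * Stable sets in a neighbourhood *)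

Section StableSets.
Variable G : sgraph.
Implicit Types (x y : G) (A B : {set G}).

Definition non_nbhd x : {set G} := [set y | (y != x) && ~~ adj x y].

Definition stable_sets n A : {set {set G}} :=
  [set B : {set G} | [&& B \subset A, #|B| == n &
    [forall x in B, forall y in B, ~~ adj x y]]].

Lemma stableP B :
  reflect {in B &, forall x y, ~~ adj x y}
    [forall x in B, forall y in B, ~~ adj x y].
Proof.
apply: (iffP forall_inP) => [h x y Bx By | h x Bx].
  by move/forall_inP: (h x Bx); apply.
by apply/forall_inP => y By; apply: h.
Qed.

Lemma card_stable_sets1 A : #|stable_sets 1 A| = #|A|.
Proof.
rewrite -(card_imset (mem A) (@set1_inj G)); apply: eq_card => B.
rewrite inE; apply/and3P/imsetP => [[sBA /cards1P[x defB] _] | [x Ax ->]].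
  by exists x => //; move: sBA; rewrite defB sub1set.
split; rewrite ?sub1set ?cards1 //.
by apply/stableP => y z /set1P-> /set1P->; rewrite adj_irrefl.
Qed.

(** Count pairs made of a stable set and one of its elements [x]: deleting [x]
    leaves a stable set of size [n] among the non-neighbours of [x]. *)
Lemma card_stable_setsS n A :
  n.+1 * #|stable_sets n.+1 A| =
    \sum_(x in A) #|stable_sets n (A :&: non_nbhd x)|.
Proof.
rewrite mulnC -sum_nat_const.
transitivity (\sum_(B in stable_sets n.+1 A) \sum_(x in A | x \in B) 1).
  apply: eq_bigr => B; rewrite inE => /and3P[/subsetP sBA /eqP cB _].
  rewrite sum1dep_card -[in LHS]cB; apply: eq_card => x; rewrite inE.
  by case Bx: (x \in B); rewrite ?andbF // sBA.
rewrite (exchange_big_dep (mem A)) //=.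
apply: eq_bigr => x Ax; rewrite sum1dep_card.
rewrite -(@card_in_imset _ _ (fun B => x |: B)
  (mem (stable_sets n (A :&: non_nbhd x)))).
  apply: eq_card => B; rewrite !inE.
  apply/andP/imsetP => [[/and3P[sBA /eqP cB /stableP stB] /andP[_ Bx]] | [C + ->]].
    exists (B :\ x); last by rewrite setD1K.
    rewrite inE; apply/and3P; split.
    - apply/subsetP => y /setD1P[yx By]; rewrite !inE yx (subsetP sBA) //=.
      exact: stB.
    - by move: (cardsD1 x B); rewrite Bx cB add1n => -[<-].
    - by apply/stableP => y z /setD1P[_ By] /setD1P[_ Bz]; apply: stB.
  rewrite inE => /and3P[/subsetP sC /eqP cC /stableP stC].
  split; last by rewrite Ax setU11.
  apply/and3P; split.
  - apply/subsetP => y /setU1P[-> // | /sC]; by rewrite !inE => /andP[].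
  - rewrite cardsU1 cC -[X in _ == X]add1n eqn_add2r eqb1.
    by apply/negP => /sC; rewrite !inE eqxx andbF.
  - apply/stableP => y z /setU1P[-> | Cy] /setU1P[-> | Cz].
    + by rewrite adj_irrefl.
    + by move/sC: Cz; rewrite !inE => /and3P[].
    + by rewrite adj_sym; move/sC: Cy; rewrite !inE => /and3P[].
    + exact: stC.
  have notin C : C \in stable_sets n (A :&: non_nbhd x) -> x \notin C.
    rewrite inE => /and3P[/subsetP sC _ _].
    by apply/negP => /sC; rewrite !inE eqxx andbF.
  move=> B C /notin xB /notin xC eqBC.
  by rewrite -(setU1K xB) eqBC setU1K.
by move=> B x _ /andP[].
Qed.

(** Among the 2-subsets of the neighbourhood, those that are not edges are the
    stable ones, so the integer subtraction defining [nonadj_pairs] is a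
    cardinality. *)
Lemma nonadj_pairsE v : nonadj_pairs v = (#|stable_sets 2 (nbhd v)|%:Z)%R.
Proof.
rewrite /nonadj_pairs /degree; set A := nbhd v.
rewrite -cards_draws.
set S := [set B | _].
have eqE : edges_in A = S :\: stable_sets 2 A.
  apply/setP => B; rewrite !inE.
  apply/imset2P/andP => [[x y Ax] | [nst /andP[sBA cB]]].
    rewrite inE => /andP[Ay xy] ->; split.
      apply/negP => /and3P[_ _ /stableP st].
      by case/negP: (st x y (set21 x y) (set22 x y)).
    rewrite subUset !sub1set Ax Ay /= cards2.
    by have [eq_xy|] := eqVneq x y; rewrite // eq_xy adj_irrefl in xy.
  case/cards2P: (cB) sBA nst => x [y [xy ->]].
  rewrite subUset !sub1set => /andP[Ax Ay].
  rewrite Ax Ay cards2 xy /= => nst.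
  exists x y => //; rewrite inE Ay /=.
  apply: contraR nst => nxy; apply/stableP => a b.
  by move=> /set2P[]-> /set2P[]->; rewrite ?adj_irrefl // adj_sym.
have sub : stable_sets 2 A \subset S.
  by apply/subsetP => B; rewrite !inE => /and3P[-> ->].
by rewrite eqE cardsDS // subzn ?leq_subr ?subset_leq_card // subKn ?subset_leq_card.
Qed.

Lemma nonadj_triplesE v : nonadj_triples v = #|stable_sets 3 (nbhd v)|.
Proof. by []. Qed.

Lemma nonadj_pairs_regular v p :
    {in nbhd v, forall x, #|nbhd v :&: non_nbhd x| = p} ->
  (2 * #|stable_sets 2 (nbhd v)| = degree v * p)%N.
Proof.
move=> reg; rewrite card_stable_setsS -sum_nat_const.
by apply: eq_bigr => x /reg <-; rewrite card_stable_sets1.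
Qed.

Lemma nonadj_triples_regular v p q :
    {in nbhd v, forall x, #|nbhd v :&: non_nbhd x| = p} ->
    {in nbhd v, forall x, {in nbhd v :&: non_nbhd x, forall y,
      #|nbhd v :&: non_nbhd x :&: non_nbhd y| = q}} ->
  (6 * #|stable_sets 3 (nbhd v)| = degree v * p * q)%N.
Proof.
move=> reg1 reg2; rewrite -[6]/(2 * 3) -mulnA card_stable_setsS big_distrr /=.
rewrite -mulnA -sum_nat_const; apply: eq_bigr => x vx.
rewrite card_stable_setsS -(reg1 x vx) -sum_nat_const.
by apply: eq_bigr => y /(reg2 x vx) <-; rewrite card_stable_sets1.
Qed.

End StableSets.

(** * Counting lines in an affine plane *)

Section AffinePlaneCounting.
Variables (A : affine_plane) (k : nat).
Hypotheses (k_gt0 : (0 < k)%N) (ordA : has_order A k).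
Implicit Types (p q : point A) (l m n : {set point A}).

Lemma line_exists p q : p != q ->
  exists2 l, l \in lines A & (p \in l) && (q \in l).
Proof. by case/line_through => l [[lA pl ql] _]; exists l; rewrite ?pl. Qed.

Lemma line_eq p q l m : l \in lines A -> m \in lines A -> p != q ->
  p \in l -> q \in l -> p \in m -> q \in m -> l = m.
Proof.
move=> lA mA /line_through[n [_ uniq_n]] pl ql pm qm.
by rewrite -(uniq_n l) // -(uniq_n m).
Qed.

Lemma line_nonempty l : l \in lines A -> exists p, p \in l.
Proof. by move/ordA => cl; apply/card_gt0P; rewrite cl. Qed.

Lemma parallel_eq p l m n : l \in lines A -> m \in lines A -> n \in lines A ->
  p \notin l -> p \in m -> p \in n -> [disjoint m & l] -> [disjoint n & l] ->
  m = n.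
Proof.
move=> lA mA nA pl pm pn ml nl.
have [h [_ uniq_h]] := parallel_through lA pl.
by rewrite -(uniq_h m) // -(uniq_h n).
Qed.

(** A common point of [l] and [n] would carry two parallels to [m]. *)
Lemma parallel_trans l m n : l \in lines A -> m \in lines A -> n \in lines A ->
  [disjoint l & m] -> [disjoint m & n] -> l != n -> [disjoint l & n].
Proof.
move=> lA mA nA lm mn; apply: contraR => /pred0Pn[p /andP[/= pl pn]].
apply/eqP/(@parallel_eq p m) => //; last by rewrite disjoint_sym.
by apply/negP => pm; rewrite (disjointFr lm pl) in pm.
Qed.

(** The source of the counts below: lines that are distinct from [l] and meet it
    do so in exactly one point, so they can be counted through the
    points of [l]. *)
Lemma card_transversals l (S : {set {set point A}}) c : l \in lines A ->
    {in S, forall m, [/\ m \in lines A, m != l & ~~ [disjoint m & l]]} ->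
    {in l, forall p, #|[set m in S | p \in m]| = c} ->
  #|S| = (k * c)%N.
Proof.
move=> lA Sl cS; rewrite -(ordA lA) -sum_nat_const -sum1_card.
transitivity (\sum_(m in S) \sum_(p in l | p \in m) 1)%N.
  apply: eq_bigr => m /Sl[mA neq_ml /pred0Pn[p /andP[/= pm pl]]].
  rewrite (bigD1 p) ?pl //= big1 // => q /andP[/andP[ql qm] qp].
  by case/eqP: neq_ml; apply: (@line_eq q p).
rewrite (exchange_big_dep (mem l)) /=; last by move=> m p _ /andP[].
apply: eq_bigr => p pl; rewrite -(cS p pl) sum1dep_card.
by apply: eq_card => m; rewrite !inE pl.
Qed.

Definition crossing l := [set m in lines A | (m != l) && ~~ [disjoint m & l]].

(** Each of the [k] points of [l] is joined to [p] by exactly one line. *)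
Lemma card_crossing_through_out l p : l \in lines A -> p \notin l ->
  #|[set m in crossing l | p \in m]| = k.
Proof.
move=> lA pl; rewrite -[RHS]muln1; apply: (card_transversals lA) => [m|q ql].
  by rewrite !inE => /andP[/and3P[]].
have /line_through[m [[mA pm qm] uniq_m]] : p != q by apply: contraNneq pl => ->.
apply/eqP/cards1P; exists m; apply/setP => n; rewrite !inE.
apply/idP/eqP => [/andP[/andP[/and3P[nA _ _] pn] qn] | ->].
  by rewrite -(uniq_m n).
rewrite mA pm qm !andbT /=; apply/andP; split.
  by apply: contraNneq pl => <-.
by apply/pred0Pn; exists q; rewrite /= qm.
Qed.

Lemma line_avoiding p : exists2 l, l \in lines A & p \notin l.
Proof.
have [a [b [c [/and3P[]]]]] := noncollinear A.
rewrite !inE negb_or => /andP[ab ac] bc _ ncol.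
have [l1 l1A /andP[al1 bl1]] := line_exists ab.
have [l2 l2A /andP[al2 cl2]] := line_exists ac.
have [l3 l3A /andP[bl3 cl3]] := line_exists bc.
have [pl1|] := boolP (p \in l1); last by exists l1.
have [pl2|] := boolP (p \in l2); last by exists l2.
have [pl3|] := boolP (p \in l3); last by exists l3.
have [eq_pa|pa] := eqVneq p a.
  by case/negP: (ncol _ l3A); rewrite bl3 cl3 -eq_pa pl3.
case/negP: (ncol _ l1A); rewrite al1 bl1.
by rewrite (@line_eq p a l1 l2).
Qed.

(** Relative to a line [l] that avoids [p], the lines through [p] are the [k]
    ones that cross [l] and the unique parallel. *)
Lemma card_lines_through p : #|[set m in lines A | p \in m]| = k.+1.
Proof.
have [l lA pl] := line_avoiding p.
have [h [[hA ph hl] uniq_h]] := parallel_through lA pl.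
rewrite (cardsD1 h) inE hA ph add1n; congr _.+1.
rewrite -(card_crossing_through_out lA pl); apply: eq_card => m; rewrite !inE.
case mA: (m \in lines A); rewrite ?andbF //=.
case pm: (p \in m); rewrite ?andbF //= !andbT.
have -> /= : m != l by apply: contraNneq pl => <-.
congr (~~ _); apply/eqP/idP => [-> // | ml].
by rewrite (uniq_h m).
Qed.

(** For [p] on [l], the lines through [p] that cross [l] are all the lines
    through [p] but [l] itself. *)
Lemma card_crossing_through l p : l \in lines A ->
  #|[set m in crossing l | p \in m]| = k.
Proof.
move=> lA; have [pl|] := boolP (p \in l); last exact: card_crossing_through_out.
apply/succn_inj; rewrite -(card_lines_through p) (cardsD1 l [set m in lines A | _]).
rewrite !inE lA pl /= add1n; congr _.+1; apply: eq_card => m; rewrite !inE.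
case pm: (p \in m); rewrite ?andbF //= !andbT andbC.
have -> : ~~ [disjoint m & l] by apply/pred0Pn; exists p; rewrite /= pm.
by rewrite andbT andbC.
Qed.

Lemma card_crossing l : l \in lines A -> #|crossing l| = (k * k)%N.
Proof.
move=> lA; apply: (card_transversals lA) => [m|p _].
  by rewrite inE => /and3P[].
exact: card_crossing_through.
Qed.

(** A line [t] crossing [l] meets each member of the parallel class of [l], and
    each of its [k] points lies on exactly one member; the class has thus [k]
    members, [l] included. *)
Lemma card_parallels l : l \in lines A ->
  #|[set m in lines A | [disjoint m & l]]| = k.-1.
Proof.
move=> lA; have [p pl] := line_nonempty lA.
have: (0 < #|[set m in crossing l | p \in m]|)%N by rewrite card_crossing_through.
case/card_gt0P => t; rewrite !inE => /andP[/and3P[tA tl _] pt].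
have neq_p q : q \in t -> q != p -> q \notin l.
  move=> qt qp; apply: contra tl => ql; apply/eqP; exact: (@line_eq q p).
set S := [set m in _ | _].
have lS : l \notin S.
  by rewrite inE lA; apply/pred0Pn; exists p; rewrite /= pl.
suff: #|l |: S| = k by rewrite cardsU1 lS /= add1n => <-.
rewrite -[RHS]muln1; apply: (card_transversals tA) => [m|q qt].
  case/setU1P => [-> | ].
    by split; rewrite // 1?eq_sym //; apply/pred0Pn; exists p; rewrite /= pl.
  rewrite inE => /andP[mA ml]; have pm : p \notin m.
    by apply/negP => pm; rewrite (disjointFr ml pm) in pl.
  split=> //; first by apply: contraNneq pm => ->.
  apply: contra tl; rewrite disjoint_sym => tm; apply/eqP.
  by apply: (@parallel_eq p m) => //; rewrite disjoint_sym.
apply/eqP/cards1P; have [-> | qp] := eqVneq q p.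
  exists l; apply/setP => m; rewrite !inE.
  case: eqP => [-> | _] //=.
  by apply/andP => -[/andP[_ ml] pm]; rewrite (disjointFr ml pm) in pl.
have ql := neq_p q qt qp.
have [h [[hA qh hl] uniq_h]] := parallel_through lA ql.
exists h; apply/setP => m; rewrite !inE.
apply/idP/eqP => [/andP[/orP[/eqP-> | /andP[mA ml]] qm] | ->].
- by rewrite qm in ql.
- by rewrite -(uniq_h m).
- by rewrite hA hl qh orbT.
Qed.

Lemma parallel_crossing e l m : e \in lines A -> l \in crossing e ->
  m \in lines A -> [disjoint m & l] -> m \in crossing e.
Proof.
rewrite !inE => eA /and3P[lA le lce] mA ml; rewrite mA /=.
apply/andP; split.
  by apply: contraNneq lce => <-; rewrite disjoint_sym.
apply: contra lce => me; apply: (@parallel_trans l m e) => //.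
by rewrite disjoint_sym.
Qed.

Lemma card_common_parallels l m : l \in lines A -> m \in lines A ->
    [disjoint m & l] ->
  #|[set n in lines A | [disjoint n & l] && [disjoint n & m]]| = k.-2.
Proof.
move=> lA mA ml; apply/esym.
rewrite -(card_parallels lA) (cardsD1 m) inE mA ml /=.
apply/esym/eq_card => n; rewrite !inE.
case nA: (n \in lines A); rewrite ?andbF //= andbC.
case nl: [disjoint n & l]; rewrite ?andbF ?andbT //.
apply/idP/idP => [nm | ].
  have [p pn] := line_nonempty nA.
  by apply: contraTneq nm => <-; apply/pred0Pn; exists p; rewrite /= pn.
by apply: (@parallel_trans n l m) => //; rewrite disjoint_sym.
Qed.

End AffinePlaneCounting.

(** * The blown-up plane *)

Lemma uniform_t_simple k (H : hypergraph) : uniform k H -> t_simple k H.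
Proof. by move=> unif f g _; rewrite -(unif f) subset_leq_card ?subsetIl. Qed.

Section Construction.
Variables (A : affine_plane) (k mult : nat) (e0 : {set point A}).
Hypotheses (k_gt0 : (0 < k)%N) (ordA : has_order A k) (e0A : e0 \in lines A).

Definition copy : finType := ({l | l \in crossing e0} * 'I_mult)%type.

(** [None] indexes the single edge [e0], which is not repeated. *)
Definition copy_ends (f : option copy) : {set point A} :=
  if f is Some (l, _) then val l else e0.

Definition blowup : hypergraph := Hypergraph copy_ends.

Lemma copy_ends_line f : copy_ends f \in lines A.
Proof.
case: f => [[[l /= lce] i]|] //=.
by move: lce; rewrite inE => /and3P[].
Qed.

Lemma blowup_uniform : uniform k blowup.
Proof. by move=> f; apply/ordA/copy_ends_line. Qed.

Lemma card_copies (P : pred {set point A}) :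
  #|[set f : hedge blowup | if f is Some (l, _) then P (val l) else false]|
  = (#|[set l in crossing e0 | P l]| * mult)%N.
Proof.
pose B := [set l : {l | l \in crossing e0} | P (val l)].
have <- : #|B| = #|[set l in crossing e0 | P l]|.
  rewrite -(card_imset _ val_inj); apply: eq_card => l; rewrite !inE.
  apply/imsetP/andP => [[l' + ->] | [lce Pl]].
    by rewrite inE => Pl'; split=> //; have := valP l'; rewrite inE.
  have lce' : l \in crossing e0 by rewrite inE.
  by exists (exist _ l lce'); rewrite ?inE.
apply/esym; rewrite -[X in (_ * X)%N]card_ord -cardsT -cardsX.
rewrite -(card_imset _ (@Some_inj _)).
apply/esym/eq_card => -[[l i]|]; rewrite !inE.
  apply/idP/imsetP => [Pl | [[l' i'] + [-> _]]].
    by exists (l, i); rewrite ?inE ?Pl.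
  by rewrite !inE => /andP[].
by apply/esym/imsetP => -[].
Qed.

(** The extra 1 accounts for [e0], which lies on top of the [k] crossing lines
    through each of its points. *)
Lemma blowup_max_hdegree : (max_hdegree blowup <= (k * mult).+1)%N.
Proof.
apply/bigmax_leqP => /= p _; rewrite /hdegree.
rewrite (cardsD1 None) -add1n leq_add ?leq_b1 //.
rewrite -(card_crossing_through ordA p e0A).
rewrite -(card_copies (fun l => p \in l)); apply/eq_leq/eq_card => -[[l i]|];
  by rewrite !inE.
Qed.

Let G := line_graph blowup.
Let e : G := None : hedge blowup.

Lemma blowup_nbhd :
  nbhd e = [set f : hedge blowup | if f is Some (l, _) then true else false].
Proof.
apply/setP => -[[[l /= lce] i]|]; rewrite !inE /= /line_adj //=.
move: lce; rewrite inE => /and3P[_ _]; rewrite setI_eq0 disjoint_sym => -> //.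
Qed.

Lemma blowup_degree : degree e = (k * k * mult)%N.
Proof.
rewrite /degree blowup_nbhd -(card_crossing ordA e0A).
rewrite (card_copies predT); congr (_ * _)%N; apply: eq_card => l.
by rewrite !inE andbT.
Qed.

(** Copies of one line are adjacent, because lines are nonempty; for that reason
    disjointness alone captures being distinct and non-adjacent. *)
Lemma blowup_nonadj (f g : hedge blowup) :
  (g \in non_nbhd (f : G)) = [disjoint copy_ends g & copy_ends f].
Proof.
rewrite !inE /= /line_adj eq_sym setI_eq0 disjoint_sym.
have [-> | fg] := eqVneq f g; last by rewrite /= negbK.
have [p pg] := line_nonempty k_gt0 ordA (copy_ends_line g).
by apply/esym/pred0Pn; exists p; rewrite /= pg.
Qed.

(** A line parallel to a line crossing [e0] also crosses [e0], hence none of the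
    [k.-1] parallels was discarded. *)
Lemma blowup_parallels l i :
  #|nbhd e :&: non_nbhd (Some (l, i) : G)| = (k.-1 * mult)%N.
Proof.
have lA := copy_ends_line (Some (l, i)).
rewrite -(card_parallels k_gt0 ordA lA) /=.
transitivity #|[set f : hedge blowup |
    if f is Some (m, _) then [disjoint val m & val l] else false]|.
  apply: eq_card => f; rewrite inE blowup_nonadj blowup_nbhd.
  by case: f => [[m j]|]; rewrite !inE.
rewrite (card_copies (fun m => [disjoint m & val l])); congr (_ * _)%N.
apply: eq_card => m; rewrite [LHS]inE [RHS]inE.
case ml: [disjoint m & val l]; rewrite ?andbF // !andbT.
apply/idP/idP => [|mA]; first by rewrite inE => /andP[].
exact: (parallel_crossing e0A (valP l)).
Qed.

Lemma blowup_common_parallels (l l' : {l | l \in crossing e0}) (i i' : 'I_mult) :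
    [disjoint val l' & val l] ->
  #|nbhd e :&: non_nbhd (Some (l, i) : G) :&: non_nbhd (Some (l', i') : G)|
  = (k.-2 * mult)%N.
Proof.
move=> ll'.
have lA := copy_ends_line (Some (l, i)).
have l'A := copy_ends_line (Some (l', i')).
rewrite -(card_common_parallels k_gt0 ordA lA l'A ll') /=.
transitivity #|[set f : hedge blowup |
    if f is Some (m, _) then [disjoint val m & val l] && [disjoint val m & val l']
    else false]|.
  apply: eq_card => f; rewrite 2!inE !blowup_nonadj blowup_nbhd.
  by case: f => [[m j]|]; rewrite !inE.
rewrite (card_copies (fun m => [disjoint m & val l] && [disjoint m & val l'])).
congr (_ * _)%N.
apply: eq_card => m; rewrite [LHS]inE [RHS]inE.
case ml: [disjoint m & val l]; rewrite ?andbF //=.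
congr (_ && _); apply/idP/idP => [|mA]; first by rewrite inE => /andP[].
exact: (parallel_crossing e0A (valP l)).
Qed.

Lemma blowup_stable_pairs :
  (2 * #|stable_sets 2 (nbhd e)| = (k * mult) * (k * mult) * k.-1)%N.
Proof.
rewrite (@nonadj_pairs_regular _ _ (k.-1 * mult)%N).
  by rewrite blowup_degree; ring.
move=> [[l i]|]; last by rewrite blowup_nbhd inE.
by rewrite blowup_parallels.
Qed.

(** The factor [k] on the left makes the right-hand side a multiple of
    [(k * mult) ^ 3], the only form in which [mult] enters the limit. *)
Lemma blowup_stable_triples :
  (6 * k * #|stable_sets 3 (nbhd e)| = (k * mult) ^ 3 * k.-1 * k.-2)%N.
Proof.
rewrite mulnAC (@nonadj_triples_regular _ _ (k.-1 * mult)%N (k.-2 * mult)%N).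
- by rewrite blowup_degree; ring.
- move=> [[l i]|]; last by rewrite blowup_nbhd inE.
  by rewrite blowup_parallels.
move=> [[l i]|]; last by rewrite blowup_nbhd inE.
move=> _ [[l' i']|]; last by rewrite blowup_nbhd !inE.
rewrite inE blowup_nonadj => /andP[_ ll'].
exact: blowup_common_parallels.
Qed.

End Construction.

(** * The affine plane over a finite field *)

Section FieldPlane.
Local Open Scope ring_scope.
Variable F : finFieldType.
Implicit Types (p q r d : (F * F)%type) (l m : {set F * F}).

Definition cross p q : F := p.1 * q.2 - p.2 * q.1.

(** The line through [p] directed by [d]. The equation [cross (q - p) d == 0]
    makes the incidence axioms polynomial identities. *)
Definition field_line p d : {set F * F} :=
  [set q : F * F | cross (q - p) d == 0].

Definition field_lines : {set {set F * F}} :=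
  [set field_line p d | p : F * F, d : F * F in [set d : F * F | d != 0]].

Lemma field_linesP l : reflect (exists p d, d != 0 /\ l = field_line p d)
  (l \in field_lines).
Proof.
apply: (iffP imset2P) => [[p d _] | [p [d [d0 ->]]]].
  by rewrite inE => d0 ->; exists p, d.
by exists p d; rewrite ?inE.
Qed.

(** Passing from the equation of a line to its parametrization. *)
Lemma cross_eq0P p d : d != 0 ->
  reflect (exists t, p = (t * d.1, t * d.2)) (cross p d == 0).
Proof.
move=> d0; apply: (iffP eqP) => [|[t ->]]; last by rewrite /cross /=; ring.
case: p d d0 => [a b] [u v]; rewrite /cross /= xpair_eqE negb_and.
move=> uv0 /subr0_eq ab; case/orP: uv0 => [u0|v0].
  exists (a / u); congr (_, _); first by field.
  by apply: (mulIf u0); rewrite -ab; field.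
exists (b / v); congr (_, _); last by field.
by apply: (mulIf v0); rewrite ab; field.
Qed.

Lemma field_line_start p d : p \in field_line p d.
Proof. by rewrite inE subrr /cross /= !mul0r subrr. Qed.

Lemma field_line_redirect p d q : d != 0 -> q \in field_line p d -> q != p ->
  field_line p d = field_line p (q - p).
Proof.
move=> d0; rewrite inE => /(cross_eq0P _ d0)[t eq_t] qp.
have t0 : t != 0.
  by apply: contraNneq qp => t0; rewrite -subr_eq0 eq_t t0 !mul0r.
apply/setP => r; rewrite !inE eq_t.
rewrite (_ : cross _ (t * d.1, _) = t * cross (r - p) d); last first.
  by rewrite /cross /=; ring.
by rewrite mulf_eq0 (negPf t0).
Qed.

Lemma field_line_rebase p d q : q \in field_line p d ->
  field_line p d = field_line q d.
Proof.
rewrite inE => /eqP qpd; apply/setP => r; rewrite !inE.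
rewrite (_ : cross (r - p) d = cross (q - p) d + cross (r - q) d).
  by rewrite qpd add0r.
by rewrite /cross /=; ring.
Qed.

Lemma field_line_through p q : p != q ->
  exists! l : {set F * F}, [/\ l \in field_lines, p \in l & q \in l].
Proof.
move=> pq; have d0 : q - p != 0 by rewrite subr_eq0 eq_sym.
exists (field_line p (q - p)); split.
  split; first by apply/field_linesP; exists p, (q - p).
    exact: field_line_start.
  by rewrite inE /cross mulrC subrr.
move=> l [/field_linesP[r [d [d0' ->]]] pl ql].
rewrite (field_line_rebase pl) (@field_line_redirect p d q) // 1?eq_sym //.
by rewrite -(field_line_rebase pl).
Qed.

Lemma field_parallel_through l p : l \in field_lines -> p \notin l ->
  exists! m : {set F * F}, [/\ m \in field_lines, p \in m & [disjoint m & l]].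
Proof.
case/field_linesP => r [d [d0 ->]] pl; exists (field_line p d); split.
  split; [by apply/field_linesP; exists p, d | exact: field_line_start |].
  apply/pred0Pn => -[q /andP[/= qp qr]]; case/negP: pl.
  by rewrite (field_line_rebase qr) -(field_line_rebase qp) field_line_start.
move=> m [/field_linesP[q [d' [d0' ->]]] pm].
rewrite (field_line_rebase pm) => dis.
have dd' : cross d' d == 0.
  apply: contraTT dis => dd'; apply/pred0Pn.
  (* Cramer's rule: solve cross (p + t * d' - r) d = 0 for t. *)
  pose t := cross (r - p) d / cross d' d.
  exists (p + (t * d'.1, t * d'.2)); rewrite /= !inE; apply/andP; split.
    by apply/eqP; rewrite /cross /=; ring.
  apply/eqP; transitivity (t * cross d' d - cross (r - p) d).
    by rewrite /cross /=; ring.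
  by rewrite /t divfK // subrr.
have eq_d' : p + d' - p = d' by rewrite addrAC subrr add0r.
rewrite (field_line_redirect (q := p + d') d0) ?eq_d' //; first by rewrite inE eq_d'.
by rewrite -subr_eq0 eq_d'.
Qed.

Lemma field_noncollinear : exists p q r, uniq [:: p; q; r] /\
  (forall l, l \in field_lines -> ~~ [&& p \in l, q \in l & r \in l]).
Proof.
exists (0, 0), (1, 0), (0, 1); split.
  by rewrite /= !inE !xpair_eqE !eqxx oner_eq0 eq_sym oner_eq0.
move=> l /field_linesP[p [d [d0 ->]]]; apply/and3P => -[h0].
rewrite (field_line_rebase h0) !inE /cross /=.
rewrite !subr0 !mul0r !mul1r subr0 sub0r oppr_eq0 => /eqP d2 /eqP d1.
by case/eqP: d0; case: d d1 d2 {h0} => a b /= -> ->.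
Qed.

Definition field_plane : affine_plane :=
  AffinePlane field_line_through field_parallel_through field_noncollinear.

Lemma field_plane_order : has_order field_plane #|F|.
Proof.
move=> _ /field_linesP[p [d [d0 ->]]].
rewrite -cardsT -(@card_imset _ _ (fun t : F => p + (t * d.1, t * d.2))).
  apply: eq_card => q; rewrite inE.
  apply/(cross_eq0P _ d0)/imsetP => [[t eq_t] | [t _ ->]].
    by exists t; rewrite // -eq_t addrC subrK.
  by exists t; rewrite addrC addKr.
move=> s t /addrI[]; move: d0; case: d => a b /=; rewrite xpair_eqE negb_and.
by case/orP => [a0 /(mulIf a0) | b0 _ /(mulIf b0)].
Qed.

End FieldPlane.

(** * The value of b at the central edge *)

Section Profile.
Local Open Scope ring_scope.
Variable R : numFieldType.
Implicit Types (k D : nat) (t : R).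

Definition pair_coef k : R := (k%:R - 1) / (2 * k%:R ^+ 2).
Definition triple_coef k : R := (k%:R - 1) * (k%:R - 2) / (6 * k%:R ^+ 4).

(** The value of b at [e], as a function of the fraction of the maximum degree
    in the line graph that [e] attains; its value at 1 is the limit. *)
Definition profile k t : R := t - pair_coef k * t ^+ 2 + triple_coef k * t ^+ 3.

(** The ratio [degree e / (k * D)], after cancelling a factor [k]. *)
Definition saturation k D : R := (k * (D.-1 %/ k))%N%:R / D%:R.

Lemma bfun_blowup (A : affine_plane) k D (e0 : {set point A}) :
    (0 < k)%N -> (0 < D)%N -> has_order A k -> e0 \in lines A ->
  bfun (G := line_graph (blowup (D.-1 %/ k) e0)) (k * D)%N%:R
    (None : hedge (blowup (D.-1 %/ k) e0)) = profile k (saturation k D).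
Proof.
move=> k0 D0 ordA e0A; rewrite /bfun nonadj_pairsE nonadj_triplesE.
rewrite (blowup_degree _ ordA e0A) /profile /pair_coef /triple_coef /saturation.
have := blowup_stable_pairs (D.-1 %/ k) k0 ordA e0A.
have := blowup_stable_triples (D.-1 %/ k) k0 ordA e0A.
set s3 := #|_|; set s2 := #|_|; set m := (D.-1 %/ k)%N => eq3 eq2.
have kR : k%:R != 0 :> R by rewrite pnatr_eq0 -lt0n.
have DR : D%:R != 0 :> R by rewrite pnatr_eq0 -lt0n.
have k1 : k.-1%:R = k%:R - 1 :> R by rewrite -subn1 natrB.
have k2 : (k.-1 * k.-2)%:R = (k%:R - 1) * (k%:R - 2) :> R.
  (* For k = 1 the truncation k.-2 = 0 is harmless: the factor k - 1 vanishes. *)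
  rewrite natrM k1; case: (k) k0 => [|[|n]] // _; first by rewrite subrr !mul0r.
  by rewrite -[n.+2.-2]/n (_ : n.+2%:R = n%:R + 2) ?addrK // -natrD addn2.
have s2E : s2%:R = (k * m)%:R ^+ 2 * (k%:R - 1) / 2 :> R.
  by rewrite -k1 -natrX -natrM -mulnn -eq2 natrM mulrAC divff ?mul1r // pnatr_eq0.
have s3E : s3%:R = (k * m)%:R ^+ 3 * ((k%:R - 1) * (k%:R - 2)) / (6 * k%:R) :> R.
  apply: canRL (mulfK _) _; first by rewrite mulf_neq0 ?pnatr_eq0 // -lt0n.
  by rewrite mulrC -natrX -k2 -!natrM eq3 mulnA.
rewrite -pmulrn s2E s3E !natrM.
by field; rewrite DR kR.
Qed.

Lemma affine_plane_hypergraph (A : affine_plane) k D :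
    (0 < k)%N -> has_order A k -> (0 < D)%N ->
  exists (H : hypergraph) (e : hedge H),
    [/\ uniform k H, t_simple k H, (max_hdegree H <= D)%N &
        bfun (G := line_graph H) (k * D)%N%:R e = profile k (saturation k D)].
Proof.
move=> k0 ordA D0.
have [p _] := noncollinear A; have [e0 e0A _] := line_avoiding p.
exists (blowup (D.-1 %/ k) e0), None; split.
- exact: blowup_uniform.
- by apply: uniform_t_simple; apply: blowup_uniform.
- apply: leq_trans (blowup_max_hdegree (D.-1 %/ k) ordA e0A) _.
  by rewrite -[ltnRHS](prednK D0) ltnS mulnC leq_trunc_div.
- exact: bfun_blowup.
Qed.

End Profile.

(** * The limit *)

(* The names of classical sets hide those of finite sets, on which all the
   parts above rely; this is why the analysis is loaded only here. *)
From mathcomp Require Import lra zify.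
From mathcomp Require Import all_classical all_reals all_analysis.
Import numFieldNormedType.Exports.

Local Open Scope classical_set_scope.
Local Open Scope ring_scope.

(** Squeezed between [1 - k / D] and 1, since the rounding in [D.-1 %/ k] loses
    at most [k]. *)
Lemma saturation_cvg (R : realType) (k : nat) : (0 < k)%N ->
  saturation R k @ \oo --> (1 : R).
Proof.
move=> k0.
apply: (@squeeze_cvgr _ _ _ _ (fun D : nat => 1 - k%:R * D%:R^-1) (fun=> 1)).
- near=> D; have D0 : (0 < D)%N by near: D; exists 1%N.
  have DR : 0 < D%:R :> R by rewrite ltr0n.
  rewrite /saturation ler_pdivlMr // ler_pdivrMr // mul1r ler_nat.
  rewrite mulrBl mul1r divfK ?gt_eqF // lerBlDr -natrD ler_nat.
  have := divn_eq D.-1 k; have := ltn_pmod D.-1 k0; lia.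
- rewrite -[X in _ --> X]subr0 -(mulr0 (k%:R : R)).
  apply: cvgB; first exact: cvg_cst.
  apply: cvgMr; apply/gtr0_cvgV0; last exact: cvgr_idn.
  by near=> D; rewrite ltr0n; near: D; exists 1%N.
- exact: cvg_cst.
Unshelve. all: by end_near.
Qed.

Lemma profile_cvg (R : realType) (k : nat) : (0 < k)%N ->
  (fun D => profile k (saturation R k D) - profile k 1) @ \oo --> (0 : R).
Proof.
move=> k0; have cvg_s : saturation R k @ \oo --> (1 : R) := saturation_cvg k0.
have cvg_sX n : saturation R k D ^+ n @[D --> \oo] --> (1 ^+ n : R).
  exact: (cvg_comp _ _ cvg_s (@exprn_continuous R n 1)).
rewrite -[X in _ --> X](subrr (profile k 1)); apply: cvgB; last exact: cvg_cst.
by apply: cvgD; [apply: cvgB => //|]; exact: cvgMr (cvg_sX _).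
Qed.

Theorem lemma3p6 (R : realType) :
  (forall k : nat, (0 < k)%N ->
    (exists A : affine_plane, has_order A k) ->
    exists err : nat -> R, err @ \oo --> (0 : R) /\
      forall D : nat, (0 < D)%N ->
        exists (H : hypergraph) (e : hedge H),
          [/\ uniform k H, t_simple k H, (max_hdegree H <= D)%N &
              bfun (G := line_graph H) ((k * D)%N%:R : R) e =
                1 - (k%:R - 1) / (2 * k%:R ^+ 2)
                + (k%:R - 1) * (k%:R - 2) / (6 * k%:R ^+ 4) + err D]) /\
  (exists err : nat -> R, err @ \oo --> (0 : R) /\
    forall D : nat, (0 < D)%N ->
      exists (H : hypergraph) (e : hedge H),
        [/\ uniform 3 H, t_simple 3 H, (max_hdegree H <= D)%N &
            bfun (G := line_graph H) ((3 * D)%N%:R : R) e >=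
              1 - 1 / 9 + 1 / 3 ^+ 5 - err D]).
Proof.
split=> [k k0 [A ordA]|].
  exists (fun D => profile k (saturation R k D) - profile k 1).
  split=> [|D D0]; first exact: profile_cvg.
  have [H [e [unif simple deg b_e]]] := affine_plane_hypergraph R k0 ordA D0.
  exists H, e; split=> //.
  by rewrite b_e /profile /pair_coef /triple_coef; ring.
have plane3 : has_order (field_plane 'F_3) 3.
  by move=> l /(@field_plane_order 'F_3) ->; rewrite card_Fp.
exists (fun D => - (profile 3 (saturation R 3 D) - profile 3 1)); split.
  by rewrite -oppr0; apply: cvgN; apply: profile_cvg.
move=> D D0.
have [H [e [unif simple deg b_e]]] := affine_plane_hypergraph R (isT : 0 < 3)%N plane3 D0.
exists H, e; split=> //.
by rewrite b_e /profile /pair_coef /triple_coef; lra.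
Qed.
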